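(* For every integer base $b\geq 2$, every fixed integer $j$ with $0<j<b$, and every positive integer $n$, $$\sum_{0\leq k\leq \log_b n}\left(\!\left(\frac{n+jb^k}{b^{k+1}}\right)\!\right)=\frac{1}{b-1}\left(s_b(n)-\frac{n}{b^{m+1}}\right)+(m+1)\left(\frac{j}{b}-\frac{1}{2}\right)-\lambda'_{b-j}+\frac{1}{2}\left[c_{\nu_b(n)}=b-j\right],$$ where the sum is over integers $k$, $((x))=x-\lfloor x\rfloor-\frac12$ if $x$ is not an integer and $((x))=0$ if $x$ is an integer, $m=\lfloor\log_b n\rfloor$ is the position of the leading digit in the $b$-ary expansion of $n$, $s_b(n)$ is the sum of the $b$-ary digits $c_s$ of $n$, $\lambda'_i$ is the number of $b$-ary digits of $n$ that are greater than or equal to $i$, and $\nu_b(n)=\max\{k:b^k\mid n\}$.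
   Context: The $b$-ary expansion of $n$ is $n=\sum_{s=0}^{m}c_sb^s$ with $c_s\in\{0,1,\dots,b-1\}$ and $c_m\neq 0$. Then $s_b(n)=\sum_{s=0}^{m}c_s$ and $\lambda'_i=\#\{s:0\leq s\leq m,\ c_s\geq i\}$; that is, $\lambda'=(\lambda'_1\geq\cdots\geq\lambda'_{b-1})$ is the transpose of the partition formed by the digits of $n$ in descending order. The bracket $[P]$ is the Iverson bracket: $1$ if $P$ is true and $0$ if $P$ is false. Thus $c_{\nu_b(n)}$ is the lowest-order nonzero $b$-ary digit of $n$. *)

(* Defs.v *)
From mathcomp Require Import all_boot all_order all_algebra.

Set Implicit Arguments.
Unset Strict Implicit.
Unset Printing Implicit Defensive.

Import Order.TTheory GRing.Theory Num.Theory.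

Definition sawtooth (R : archiRealFieldType) (x : R) : R :=
  (if x \is a Num.int then 0 else x - (Num.floor x)%:~R - 1 / 2)%R.

(* The digit c_s of n in base b; it is 0 for s > trunc_log b n.  Lemmas
   digit_expansion, digit_lead and digit_unique check that these are the
   digits of the b-ary expansion, with leading position trunc_log b n, that
   is, the integer part of the logarithm of n in base b. *)
Definition digit (b n s : nat) : nat := (n %/ b ^ s) %% b.

Definition digit_sum (b n : nat) : nat :=
  \sum_(0 <= s < (trunc_log b n).+1) digit b n s.

(* Part i of the transpose of the partition formed by the digits of n. *)
Definition digit_conj (b n i : nat) : nat :=
  #|[set s : 'I_(trunc_log b n).+1 | i <= digit b n s]|.

(* The largest k with b ^ k %| n, for an arbitrary base b > 1, whereas logn is
   restricted to prime bases.  Exponents are bounded by n as k < b ^ k; see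
   nu_spec. *)
Definition nu (b n : nat) : nat := \max_(k < n.+1 | b ^ k %| n) k.

Lemma digit_lt (b n s : nat) : 1 < b -> digit b n s < b.
Proof. by move=> b1; rewrite ltn_pmod // ltnW. Qed.

Lemma digit_expansion (b n : nat) : 1 < b ->
  n = \sum_(0 <= s < (trunc_log b n).+1) digit b n s * b ^ s.
Proof.
move=> b1.
have H k : n = \sum_(0 <= s < k) digit b n s * b ^ s + n %/ b ^ k * b ^ k.
  elim: k => [|k IH]; first by rewrite big_nil expn0 divn1 muln1.
  rewrite big_nat_recr //= -addnA {1}IH; congr (_ + _).
  rewrite {1}(divn_eq (n %/ b ^ k) b) mulnDl addnC; congr (_ + _).
  by rewrite -divnMA -mulnA -expnSr -expnS.
by rewrite {1}(H (trunc_log b n).+1) divn_small ?addn0 ?trunc_log_ltn.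
Qed.

Lemma digit_lead (b n : nat) : 1 < b -> 0 < n -> digit b n (trunc_log b n) != 0.
Proof.
move=> b1 n0; have b0 := ltnW b1; rewrite /digit modn_small.
  by rewrite -lt0n divn_gt0 ?expn_gt0 ?b0 // trunc_logP.
by rewrite ltn_divLR ?expn_gt0 ?b0 // -expnS trunc_log_ltn.
Qed.

Lemma digit_unique (b m : nat) (c : nat -> nat) (s : nat) :
  1 < b -> (forall i, c i < b) -> s <= m ->
  digit b (\sum_(0 <= i < m.+1) c i * b ^ i) s = c s.
Proof.
move=> b1; have b0 := ltnW b1.
elim: m c s => [|m IH] c s cb; last case: s => [|s] lesm.
- by rewrite leqn0 => /eqP ->; rewrite big_nat1 /digit expn0 muln1 divn1 modn_small.
- rewrite big_nat_recl // /digit expn0 muln1 divn1.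
  under eq_bigr => i _ do rewrite expnSr mulnA.
  by rewrite -big_distrl /= addnC modnMDl modn_small.
- have {}IH := IH (fun i => c i.+1) s (fun i => cb i.+1) lesm.
  rewrite big_nat_recl //; under eq_bigr => i _ do rewrite expnSr mulnA.
  rewrite -big_distrl /= expn0 muln1 -[RHS]IH /digit.
  set t := (\sum_(0 <= i < m.+1) _).
  by rewrite expnS divnMA addnC divnMDl // (divn_small (cb 0)) addn0.
Qed.

Lemma nu_spec (b n k : nat) : 1 < b -> 0 < n -> (b ^ k %| n) = (k <= nu b n).
Proof.
move=> b1 n0; apply/idP/idP => [dv|le].
  have kn : k < n.+1.
    exact: leq_trans (ltn_expl k b1) (leq_trans (dvdn_leq n0 dv) (leqnSn n)).
  exact: (@leq_bigmax_cond _ (fun i : 'I_n.+1 => b ^ i %| n) (fun i => i : nat)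
    (Ordinal kn) dv).
have dn : b ^ nu b n %| n.
  by rewrite /nu; elim/big_ind: _ => // x y Hx Hy; case: (leqP x y).
exact: dvdn_trans (dvdn_exp2l b le) dn.
Qed.

(* Main.v *)
Require Import Defs.
From mathcomp Require Import all_boot all_order all_algebra.
From mathcomp Require Import ring lra.

Import Order.TTheory GRing.Theory Num.Theory.

Local Open Scope ring_scope.

(** Writing [q k] for the quotient of [n] by [b ^ k], the [k]-th summand is
    [n / b^(k+1) - q (k+1) + j / b - 1/2], minus [1] if adding [j] to the digit
    [c k] produces a carry (that is, [b - j <= c k]), plus [1/2] if the argument
    is an integer (that is, [k] is the position of the lowest nonzero digit and
    [c k = b - j]). As [c k = q k - b * q (k+1)], the sum of the terms
    [n / b^(k+1) - q (k+1)] telescopes after multiplication by [b - 1]. *)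

Lemma floor_divn (R : archiRealFieldType) (a d : nat) : (0 < d)%N ->
  Num.floor (a%:R / d%:R : R) = (a %/ d)%N%:Z.
Proof.
move=> d0; apply: floor_def; rewrite intrD -!pmulrn natr1.
rewrite ler_pdivlMr ?ltr0n // ltr_pdivrMr ?ltr0n // -!natrM ler_nat ltr_nat.
by rewrite leq_divM -ltn_divLR ?ltnSn.
Qed.

Lemma intr_divn (R : archiRealFieldType) (a d : nat) : (0 < d)%N ->
  (a%:R / d%:R : R) \is a Num.int = (d %| a)%N.
Proof.
move=> d0; have d0R : d%:R != 0 :> R by rewrite pnatr_eq0 -lt0n.
rewrite intrEfloor floor_divn // -pmulrn -(inj_eq (mulIf d0R)) divfK //.
by rewrite -natrM eqr_nat dvdn_eq.
Qed.

(** When [d] divides [a], the generic expression equals -1/2 while the sawtooth is 0; the Iverson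
    term makes up the difference. *)
Lemma sawtooth_divn (R : archiRealFieldType) (a d : nat) : (0 < d)%N ->
  sawtooth (a%:R / d%:R : R)
  = a%:R / d%:R - (a %/ d)%N%:R - 1 / 2 + 1 / 2 * (d %| a)%N%:R.
Proof.
move=> d0; rewrite /sawtooth intr_divn // floor_divn // -pmulrn.
case: (boolP (d %| a)%N) => [da|_]; last by rewrite mulr0 addr0.
rewrite -{1}(divnK da) natrM mulfK ?pnatr_eq0 -?lt0n //=.
by lra.
Qed.

(** Dividing by [b ^ k] first leaves [n %/ b ^ k + j]. Since [j < b], adding [j] carries at most 1
    out of the lowest digit, exactly when that digit plus [j] reaches [b]. *)
Lemma divn_addM_expn (b j n k : nat) : (j < b)%N ->
  ((n + j * b ^ k) %/ b ^ k.+1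
   = n %/ b ^ k.+1 + (b - j <= digit b n k))%N.
Proof.
move=> jb; have b0 : (0 < b)%N by exact: leq_trans jb.
rewrite expnSr !divnMA divnDr ?dvdn_mull // mulnK ?expn_gt0 ?b0 // divnD //.
by rewrite (divn_small jb) addn0 (modn_small jb) leq_subLR [(j + _)%N]addnC.
Qed.

(** Either side forces [b ^ k] to divide [n]. Cancelling [b ^ k] then leaves the condition that [b]
    divides [digit b n k + j]. *)
Lemma dvdn_addM_expn (b j n k : nat) : (0 < j < b)%N -> (0 < n)%N ->
  (b ^ k.+1 %| n + j * b ^ k)%N = (k == nu b n) && (digit b n k == b - j)%N.
Proof.
move=> /andP[j0 jb] n0; have b1 : (1 < b)%N := leq_ltn_trans j0 jb.
have b0 := ltnW b1; have bk0 : (0 < b ^ k)%N by rewrite expn_gt0 b0.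
case: (boolP (b ^ k %| n)%N) => [bkn|nbkn]; last first.
  have -> : (k == nu b n) = false.
    by apply: contraNF nbkn => /eqP ->; rewrite nu_spec.
  apply: contraNF nbkn => /(dvdn_trans (dvdn_exp2l b (leqnSn k))).
  by rewrite dvdn_addl // dvdn_mull.
have -> : (b ^ k.+1 %| n + j * b ^ k)%N = (digit b n k == b - j)%N.
  rewrite -{1}(divnK bkn) -mulnDl expnS dvdn_pmul2r //.
  have -> : (b %| n %/ b ^ k + j)%N = (b %| digit b n k + j)%N.
    by rewrite /dvdn /digit modnDml.
  have cb : (digit b n k < b)%N := digit_lt n k b1.
  (* As 0 < c_k + j < 2b, the only possible multiple of [b] is [b] itself. *)
  apply/idP/eqP => [/dvdnP[[|[|q]]]|->]; last by rewrite subnK // ltnW.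
  - by rewrite mul0n => /eqP; rewrite addn_eq0 (gtn_eqF j0) andbF.
  - by rewrite mul1n => /(canRL (addnK j)).
  - move=> E; have : (digit b n k + j < b + b)%N by rewrite -addnS leq_add // ltnW.
    by rewrite E !mulSn addnA ltnNge leq_addr.
case: eqP => [ck|]; last by rewrite andbF.
(* The digit [b - j] is nonzero, so [b ^ k.+1] does not divide [n] and [k] is the exact
   valuation. *)
rewrite andbT eq_sym eqn_leq -[(k <= _)%N]nu_spec // bkn andbT leqNgt -nu_spec //.
rewrite -{1}(divnK bkn) expnS dvdn_pmul2r //.
by rewrite /dvdn -/(digit b n k) ck -lt0n subn_gt0 jb.
Qed.

Lemma nu_le_trunc_log (b n : nat) : (1 < b)%N -> (0 < n)%N ->
  (nu b n <= trunc_log b n)%N.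
Proof. by move=> b1 n0; rewrite trunc_log_max // dvdn_leq // nu_spec. Qed.

(** Put r_k = n / b^k - q_k. From q_k = b q_(k+1) + c_k follows (b - 1) r_(k+1) = c_k + r_k -
    r_(k+1), and r_0 = 0. *)
Lemma sum_frac_expn (F : numFieldType) (b n M : nat) : (0 < b)%N ->
  (b%:R - 1) * \sum_(0 <= k < M) (n%:R / b%:R ^+ k.+1 - (n %/ b ^ k.+1)%N%:R)
  = (\sum_(0 <= k < M) digit b n k)%N%:R
    - (n%:R / b%:R ^+ M - (n %/ b ^ M)%N%:R) :> F.
Proof.
move=> b0; have b0F : b%:R != 0 :> F by rewrite pnatr_eq0 -lt0n.
elim: M => [|M IH]; first by rewrite !big_nil expn0 divn1 divr1; ring.
rewrite !big_nat_recr //= mulrDr {}IH natrD.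
have -> : (n %/ b ^ M)%N%:R = (n %/ b ^ M.+1)%N%:R * b%:R + (digit b n M)%:R :> F.
  by rewrite -natrM -natrD expnSr divnMA -divn_eq.
have bM0 : b%:R ^+ M != 0 :> F by rewrite expf_neq0.
by rewrite exprS; field; rewrite b0F bM0.
Qed.

Theorem theorem10 (R : archiRealFieldType) (b j n : nat) :
  (2 <= b)%N -> (0 < j < b)%N -> (0 < n)%N ->
  let m := trunc_log b n in
  \sum_(0 <= k < m.+1)
     sawtooth ((n%:R + j%:R * b%:R ^+ k) / b%:R ^+ k.+1 : R)
  = 1 / (b%:R - 1) * ((digit_sum b n)%:R - n%:R / b%:R ^+ m.+1)
    + (m%:R + 1) * (j%:R / b%:R - 1 / 2)
    - (digit_conj b n (b - j))%:R
    + 1 / 2 * (digit b n (nu b n) == b - j)%N%:R.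
Proof.
move=> b1 jb n0 m; have b0 := ltnW b1.
have b0R : b%:R != 0 :> R by rewrite pnatr_eq0 -lt0n.
have b1R : b%:R - 1 != 0 :> R by rewrite subr_eq0 (eqr_nat R b 1) gtn_eqF.
have termE k : sawtooth ((n%:R + j%:R * b%:R ^+ k) / b%:R ^+ k.+1 : R)
    = (n%:R / b%:R ^+ k.+1 - (n %/ b ^ k.+1)%N%:R) + (j%:R / b%:R - 1 / 2)
      - (b - j <= digit b n k)%N%:R
      + 1 / 2 * ((k == nu b n) && (digit b n k == b - j)%N)%:R.
  rewrite -!natrX -natrM -natrD sawtooth_divn ?expn_gt0 ?b0 //.
  rewrite dvdn_addM_expn // divn_addM_expn; last by case/andP: jb.
  rewrite !natrD natrM !natrX exprS; field.
  by rewrite b0R expf_neq0.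
rewrite (eq_bigr _ (fun k _ => termE k)) 3!big_split /= sumrN.
congr (_ + _ - _ + _).
- have := @sum_frac_expn R b n m.+1 b0.
  (* The last quotient vanishes because n < b^(m+1). *)
  rewrite [X in (_ - X%:R)]divn_small ?trunc_log_ltn // subr0 => <-.
  by rewrite mulrA div1r mulVf // mul1r.
- by rewrite sumr_const_nat subn0 -[LHS]mulr_natl natr1.
- rewrite -natr_sum big_mkord /digit_conj -sum1_card -big_mkcond /=.
  by congr (_%:R); apply: eq_bigl => k; rewrite inE.
- rewrite -mulr_sumr; congr (_ * _).
  (* Only the index [nu b n] contributes, and it lies in the range of summation. *)
  have mem : nu b n \in index_iota 0 m.+1.
    by rewrite mem_index_iota /= ltnS nu_le_trunc_log.
  rewrite (bigD1_seq (nu b n)) ?iota_uniq //= eqxx big1 ?addr0 // => k.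
  by move=> /negbTE ->.
Qed.
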